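(* Let $\Gamma$ be a finite connected, bipartite, $d$-regular graph ($d\ge 1$) with an abelian group $G$ of automorphisms acting regularly on each shore (colour class) of the bipartition. If the nontrivial eigenvalues of $\Gamma$ take exactly $s$ distinct absolute values, then there is an $s$-distance set of size $|G|$ in $\mathbb{C}^d$.
   Context: Eigenvalues of $\Gamma$ are eigenvalues of its adjacency matrix; an eigenvalue of the bipartite $d$-regular graph $\Gamma$ is nontrivial if it is not $\pm d$. A set $X$ of unit vectors in $\mathbb{C}^d$, spanning pairwise distinct lines, is an $s$-distance set if the set $\{|x^*y|^2: x,y\in X, x\ne y\}$ has exactly $s$ elements. *)

(* Defs.v *)
From HB Require Import structures.
From mathcomp Require Import all_boot all_order all_fingroup all_algebra.
From mathcomp Require Import spectral complex.
From mathcomp Require Import boolp classical_sets functions cardinality reals.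

Set Implicit Arguments.
Unset Strict Implicit.
Unset Printing Implicit Defensive.

Import Order.TTheory GRing.Theory Num.Theory.

Section Graphs.
Variables (T : finType) (e : rel T).

Definition simple_graph : Prop := symmetric e /\ irreflexive e.

(* The empty graph is not counted as connected. *)
Definition connected_graph : Prop :=
  (0 < #|T|)%N /\ forall x y : T, connect e x y.

Definition regular_graph (d : nat) : Prop :=
  forall x : T, #|[set y | e x y]%SET| = d.

Definition bipartition (A B : {set T}) : Prop :=
  [/\ A :|: B = [set: T]%SET, [disjoint A & B] &
      forall x y : T, e x y -> (x \in A) != (y \in A)].

Definition graph_automorphism (g : {perm T}) : Prop :=
  forall x y : T, e (g x) (g y) = e x y.

(* Transitivity presupposes S nonempty and invariant under G. *)
Definition acts_regularly (G : {group {perm T}}) (S : {set T}) : Prop :=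
  [transitive G, on S | 'P] /\
  forall x : T, x \in S -> ('C_G[x | 'P] = 1)%g.

Local Open Scope ring_scope.

Definition adjacency_matrix (F : nzRingType) : 'M[F]_#|T| :=
  \matrix_(i < #|T|, j < #|T|) (e (enum_val i) (enum_val j))%:R.

Definition nontrivial_eigenvalue (R : realType) (d : nat) (a : R[i]) : Prop :=
  [/\ eigenvalue (adjacency_matrix R[i]) a, a <> d%:R & a <> - d%:R].

End Graphs.

Section DistanceSets.
Local Open Scope ring_scope.
Local Open Scope sesquilinear_scope.
Variables (R : realType) (d : nat).

Definition hdot (x y : 'cV[R[i]]_d) : R[i] := (x ^t* *m y) 0 0.

Definition distance_set (s : nat) (X : set 'cV[R[i]]_d) : Prop :=
  [/\ (forall x, X x -> hdot x x = 1),
      (forall x y, X x -> X y -> x <> y -> <[x]>%VS <> <[y]>%VS) &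
      ([set a : R[i] | exists x y,
          [/\ X x, X y, x <> y & a = `|hdot x y| ^+ 2]]%classic #= `I_s)%card].

End DistanceSets.

(* Main.v *)
Require Import Defs.
From mathcomp Require Import all_boot all_order all_fingroup all_algebra all_solvable.
From mathcomp Require Import spectral complex mxrepresentation.
From mathcomp Require Import boolp classical_sets functions cardinality reals.

(* Fix base points [a], [b] of the two shores and let [D] be the set of [h] in
   [G] such that [h b] is a neighbour of [a]; [D] has [d] elements. The vectors
   [(chi h / sqrt d)_(h in D)], for [chi] a character of [G], have inner products
   [(1/d) \sum_(h in D) (chi^* psi) h], so their angles are governed by the sums
   of nontrivial characters over [D]. Fourier transform on [G] turns the
   adjacency operator into the 2x2 blocks with off-diagonal entries
   [\sum_(h in D) chi h] and its conjugate, so the absolute values of those sums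
   are exactly those of the eigenvalues. Connectedness makes a sum of modulus [d]
   occur only for the trivial character. *)

Set Implicit Arguments.
Unset Strict Implicit.
Unset Printing Implicit Defensive.

Import Order.TTheory GRing.Theory Num.Theory.
Local Open Scope ring_scope.

(** * Linear characters and Fourier analysis on finite abelian groups *)

Section LinearCharacters.
Variables (C : numClosedFieldType) (gT : finGroupType) (G : {group gT}).

(** Only the values on [G] matter; the condition at 1 excludes functions vanishing on [G]. *)
Definition linear_character (chi : gT -> C) : Prop :=
  chi 1%g = 1 /\ {in G &, {morph chi : x y / (x * y)%g >-> x * y}}.

Lemma linear_characterX chi n :
  linear_character chi -> {in G, {morph chi : x / (x ^+ n)%g >-> x ^+ n}}.
Proof.
move=> [chi1 chiM] x Gx; elim: n => [|n IHn]; first by rewrite expg0 chi1.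
by rewrite expgS exprS chiM ?groupX // IHn.
Qed.

(** By Lagrange, [chi x] is a root of unity of order dividing [#|G|]. *)
Lemma norm_linear_character chi :
  linear_character chi -> {in G, forall x, `|chi x| = 1}.
Proof.
move=> chiL x Gx; apply/eqP; rewrite -(pexpr_eq1 (cardG_gt0 G)) // -normrX.
by rewrite -(linear_characterX _ chiL) // expg_cardG // chiL.1 normr1.
Qed.

Lemma linear_characterV chi :
  linear_character chi -> {in G, forall x, chi x^-1%g = (chi x)^*}.
Proof.
move=> chiL x Gx; have xn1 := norm_linear_character chiL Gx.
have xV : chi x * chi x^-1%g = 1.
  by rewrite -chiL.2 ?groupV // mulgV chiL.1.
have x_neq0 : chi x != 0 by rewrite -normr_eq0 xn1 oner_eq0.
by apply: (mulfI x_neq0); rewrite xV -normCK xn1 expr1n.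
Qed.

Lemma linear_character_conjM chi psi :
  linear_character chi -> linear_character psi ->
  linear_character (fun x => (chi x)^* * psi x).
Proof.
move=> [chi1 chiM] [psi1 psiM]; split=> [|x y Gx Gy].
  by rewrite chi1 psi1 rmorph1 mulr1.
by rewrite chiM // psiM // rmorphM /= mulrACA.
Qed.

(** Translation by [x] permutes [G] and multiplies the sum by [chi x]; a nonzero sum can then be
    cancelled. *)
Lemma sum_linear_character_neq0 chi :
  linear_character chi -> \sum_(x in G) chi x != 0 -> {in G, forall x, chi x = 1}.
Proof.
move=> [_ chiM] sum_neq0 x Gx; apply: (mulIf sum_neq0).
rewrite mul1r mulr_sumr [RHS](reindex_inj (mulgI x)) /=.
by apply: eq_big => y; rewrite ?groupMl // => Gy; rewrite chiM.
Qed.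

(** A convolution rule: changing variables in the sum over [G] turns each shift by [s h] into a
    factor [chi (s h)^-1]. The shift is kept general because one shore needs [h] and the other
    [h^-1]. *)
Lemma linear_character_translate_sum (I : finType) (P : pred I) (s : I -> gT)
    (chi F : gT -> C) :
  linear_character chi -> (forall h, P h -> s h \in G) ->
  \sum_(g in G) chi g * (\sum_(h | P h) F (g * s h)%g) =
  (\sum_(h | P h) chi (s h)^-1%g) * (\sum_(g in G) chi g * F g).
Proof.
move=> [_ chiM] sG; under eq_bigr do rewrite mulr_sumr.
rewrite exchange_big mulr_suml /=; apply: eq_bigr => h /sG Gh.
rewrite mulr_sumr [RHS](reindex_inj (mulIg (s h))) /=.
apply: eq_big => g; first by rewrite groupMr.
by move=> Gg; rewrite mulrCA mulrA -chiM ?groupV ?groupM // mulgK mulrC.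
Qed.

End LinearCharacters.

(** The characters are the scalars by which the irreducible representations act, all of degree one
    since [G] is abelian and [C] algebraically closed. There are as many as conjugacy classes, that
    is, as elements. Their sum is the trace of the regular representation. *)
Lemma abelian_dual (C : numClosedFieldType) (gT : finGroupType) (G : {group gT}) :
  abelian G ->
  exists (I : finType) (chi : I -> gT -> C),
    [/\ #|I| = #|G|, (forall i, linear_character G (chi i)),
        (forall i j, {in G, chi i =1 chi j} -> i = j) &
        {in G, forall x, \sum_i chi i x = #|G|%:R * (x == 1%g)%:R}].
Proof.
move=> abG; pose sG : irrType C G := DecSocleType (regular_repr C G).
have splitG : group_splitting_field C G by apply: group_closure_closed_field.
have charG : ([pchar C]^').-group%g G.
  by apply/pgroupP=> p _; rewrite inE /= pchar_num.
have deg1 := irr_degree_abelian splitG abG.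
have ZG : 'Z(G)%g = G by apply/center_idP.
have mode (i : sG) x : x \in G -> irr_repr i x = (irr_mode i x)%:M.
  by move=> Gx; apply: irr_center_scalar; rewrite ?ZG.
(* Equal scalars make two representations isomorphic through the identity matrix. The degrees are
   variables here so that their equality can be substituted. *)
have scalar_rsim (c : gT -> C) n1 n2 (r1 : mx_representation C G n1)
    (r2 : mx_representation C G n2) :
  n1 = n2 -> (forall x, x \in G -> r1 x = (c x)%:M) ->
  (forall x, x \in G -> r2 x = (c x)%:M) -> mx_rsim r1 r2.
  move=> eq_n r1c; rewrite {}eq_n in r1 r1c * => r2c.
  exists 1%:M => // [|x Gx]; first by rewrite row_free_unit unitmx1.
  by rewrite r1c // r2c // mulmx1 mul1mx.
exists sG, (@irr_mode _ _ _ sG); split=> [|i|i j eq_ij|x Gx].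
- by rewrite (card_irr_pchar _ charG splitG); apply/eqP; rewrite -card_classes_abelian.
- split; first exact: irr_mode1.
  by move=> x y Gx Gy; rewrite irr_modeM // ZG.
- rewrite -(irr_reprK_pchar charG i) -(irr_reprK_pchar charG j).
  apply: irr_comp_rsim_pchar => //; apply: (scalar_rsim (irr_mode i)).
  + by rewrite !deg1.
  + exact: mode.
  + by move=> x Gx; rewrite mode // eq_ij.
- transitivity (\tr (regular_repr C G x)).
    rewrite (mxtrace_regular_pchar sG) //; apply: eq_bigr => i _.
    transitivity (\tr (irr_repr i x) *+ irr_degree i); last by [].
    by rewrite mode // mxtrace_scalar deg1.
  (* The trace counts the fixed points of right translation by [x], and there are none unless [x] is
     1. *)
  have gring_fix k : (k == gring_index G (enum_val k * x)%g) = (x == 1%g).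
    apply/eqP/eqP => [def_k|->]; last by rewrite mulg1 gring_valK.
    apply: (mulgI (enum_val k)); rewrite mulg1 {2}def_k gring_indexK //.
    by rewrite groupM // enum_valP.
  rewrite /mxtrace mulr_natl -[in RHS](card_ord #|G|) -sumr_const.
  by apply: eq_bigr => k _; rewrite !mxE gring_fix.
Qed.

(** Fourier inversion: weighting the coefficients by [chi i g^-1] and summing over [i] recovers
    [#|G|%:R * f g], so they cannot all vanish. *)
Lemma dual_detects (C : numClosedFieldType) (gT : finGroupType) (G : {group gT})
    (I : finType) (chi : I -> gT -> C) (f : gT -> C) (g : gT) :
  (forall i, linear_character G (chi i)) ->
  {in G, forall x, \sum_i chi i x = #|G|%:R * (x == 1%g)%:R} ->
  g \in G -> f g != 0 -> exists i, \sum_(h in G) chi i h * f h != 0.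
Proof.
move=> chiL chi_sum Gg fg_neq0; apply: contrapT => /forallNP no_i.
have /eqP[] : #|G|%:R * f g != 0.
  by rewrite mulf_neq0 // pnatr_eq0 -lt0n cardG_gt0.
transitivity (\sum_i chi i g^-1%g * \sum_(h in G) chi i h * f h); last first.
  by apply: big1 => i _; have /negP/negPn/eqP-> := no_i i; rewrite mulr0.
under eq_bigr do rewrite mulr_sumr; rewrite exchange_big /= (bigD1 g) //=.
rewrite [X in _ + X]big1 => [|h /andP[Gh h_neq_g]].
  under eq_bigr do rewrite mulrA -(chiL _).2 ?groupV //.
  by rewrite -mulr_suml chi_sum ?groupM ?groupV // mulVg eqxx mulr1 addr0.
under eq_bigr do rewrite mulrA -(chiL _).2 ?groupV //.
rewrite -mulr_suml chi_sum ?groupM ?groupV //.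
by rewrite -eq_mulVg1 eq_sym (negPf h_neq_g) mulr0 mul0r.
Qed.

(** Eigenvectors of a matrix are rows indexed by ordinals; symmetry of [e] lets them be read as
    functions on vertices, summed over neighbours. *)
Lemma eigenvalue_adjacencyP {T : finType} {e : rel T} {F : fieldType} {l : F} :
  symmetric e ->
  eigenvalue (adjacency_matrix e F) l <->
  exists2 f : T -> F, (exists x, f x != 0) &
    forall x, \sum_y (e x y)%:R * f y = l * f x.
Proof.
move=> sym_e; split=> [/eigenvalueP[v vM v_neq0] | [f [x fx_neq0] fE]].
  exists (fun x => v 0 (enum_rank x)) => [|x].
    by have /rV0Pn[i vi_neq0] := v_neq0; exists (enum_val i); rewrite enum_valK.
  have /rowP/(_ (enum_rank x)) := vM; rewrite !mxE => <-.
  rewrite (reindex_onto enum_val enum_rank) => [|y _]; last exact: enum_rankK.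
  apply: eq_big => i; first by rewrite enum_valK eqxx.
  by rewrite mxE enum_valK enum_rankK mulrC sym_e.
apply/eigenvalueP; exists (\row_i f (enum_val i)); last first.
  by apply/rV0Pn; exists (enum_rank x); rewrite mxE enum_rankK.
apply/rowP => j; rewrite !mxE -fE.
rewrite [RHS](reindex_onto enum_val enum_rank) => [|y _]; last exact: enum_rankK.
apply: eq_big => i; first by rewrite enum_valK eqxx.
by rewrite !mxE mulrC sym_e.
Qed.

(** * Graphs whose vertices form two regular orbits of an abelian group *)

Section TwoRegularOrbits.
Variables (T : finType) (e : rel T) (G : {group {perm T}}) (a b : T).
Hypotheses (sym_e : symmetric e) (abG : abelian G).
Hypothesis autG : forall g : {perm T}, g \in G -> graph_automorphism e g.
Hypothesis a_inj : {in G &, injective (fun g : {perm T} => g a)}.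
Hypothesis b_inj : {in G &, injective (fun g : {perm T} => g b)}.
Hypothesis a_neq_b : {in G &, forall g h : {perm T}, g a <> h b}.
Hypothesis orbits_cover :
  forall x, exists2 g : {perm T}, g \in G & x = g a \/ x = g b.
Hypothesis a_indep : {in G, forall g : {perm T}, ~~ e a (g a)}.
Hypothesis b_indep : {in G, forall g : {perm T}, ~~ e b (g b)}.

Definition connection_set : {set {perm T}} := [set g in G | e a (g b)].

Local Notation D := connection_set.

Lemma connection_setG : {in D, forall h, h \in G}.
Proof. by move=> h; rewrite inE => /andP[]. Qed.

Lemma sum_orbits (V : nmodType) (F : T -> V) :
  \sum_x F x = \sum_(g in G) F (g a) + \sum_(g in G) F (g b).
Proof.
rewrite -(big_imset F a_inj) -(big_imset F b_inj) /=.
rewrite (bigID (mem [set g a | g : {perm T} in G]%SET)) /=; congr (_ + _).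
apply: eq_bigl => x; apply/idP/imsetP => [xNa|[g Gg ->]].
  have [g Gg [xE|->]] := orbits_cover x; last by exists g.
  by case/imsetP: xNa; exists g.
by apply/imsetP => -[h Gh /esym]; apply: a_neq_b.
Qed.

Lemma orbit_function (V : Type) (p q : {perm T} -> V) :
  exists f : T -> V, {in G, forall g : {perm T}, f (g a) = p g /\ f (g b) = q g}.
Proof.
pose f x := if [pick g in G | (g : {perm T}) a == x] is Some g then p g
            else if [pick g in G | (g : {perm T}) b == x] is Some g then q g
            else p 1%g.
exists f => g Gg; rewrite /f; split.
  case: pickP => [h /andP[Gh /eqP hg]|/(_ g)]; last by rewrite /= Gg eqxx.
  by rewrite (a_inj Gh Gg hg).
case: pickP => [h /andP[Gh /eqP]|_]; first by move/a_neq_b => [].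
case: pickP => [h /andP[Gh /eqP hg]|/(_ g)]; last by rewrite /= Gg eqxx.
by rewrite (b_inj Gh Gg hg).
Qed.

(** Apply [g^-1] to both ends. Permutations compose from left to right, so commutativity is what
    turns [(g^-1 * h) b] into [g^-1 (h b)]. *)
Lemma edge_ab : {in G &, forall g h : {perm T}, e (g a) (h b) = ((g^-1 * h)%g \in D)}.
Proof.
move=> g h Gg Gh; rewrite inE groupM ?groupV //=.
rewrite (centsP abG) ?groupV // permM.
by rewrite -{1}(permKV g (h b)) autG.
Qed.


Lemma no_edge_aa : {in G &, forall g h : {perm T}, e (g a) (h a) = false}.
Proof.
move=> g h Gg Gh; rewrite -(permKV g (h a)) autG // -permM.
by apply/negbTE/a_indep; rewrite groupM ?groupV.
Qed.

Lemma no_edge_bb : {in G &, forall g h : {perm T}, e (g b) (h b) = false}.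
Proof.
move=> g h Gg Gh; rewrite -(permKV g (h b)) autG // -permM.
by apply/negbTE/b_indep; rewrite groupM ?groupV.
Qed.

Lemma card_connection_set d : regular_graph e d -> #|D| = d.
Proof.
move=> /(_ a) <-; rewrite -(card_in_imset (f := fun h : {perm T} => h b)); last first.
  by move=> g h /connection_setG Gg /connection_setG Gh; apply: b_inj.
apply: eq_card => y; rewrite [RHS]inE; apply/imsetP/idP => [[h + ->]|].
  by rewrite inE => /andP[].
have [h Gh [->|->]] := orbits_cover y.
  by rewrite (negPf (a_indep Gh)).
by move=> ah; exists h => //; rewrite inE Gh.
Qed.

Lemma neighbour_sum_a (F : nzRingType) (f : T -> F) :
  {in G, forall g : {perm T},
    \sum_y (e (g a) y)%:R * f y = \sum_(h in D) f ((g * h)%g b)}.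
Proof.
move=> g Gg; rewrite sum_orbits big1 => [|h Gh]; last first.
  by rewrite no_edge_aa // mul0r.
rewrite add0r (reindex_inj (mulgI g)) [RHS]big_mkcond [LHS]big_mkcond /=.
apply: eq_bigr => h _; rewrite groupMl //; case: ifPn => [Gh|NGh].
  by rewrite edge_ab ?groupM // mulKg; case: ifP; rewrite ?mul1r ?mul0r.
by case: ifP => // /connection_setG; rewrite (negPf NGh).
Qed.

Lemma neighbour_sum_b (F : nzRingType) (f : T -> F) :
  {in G, forall g : {perm T},
    \sum_y (e (g b) y)%:R * f y = \sum_(h in D) f ((g * h^-1)%g a)}.
Proof.
move=> g Gg; rewrite sum_orbits [X in _ + X]big1 => [|h Gh]; last first.
  by rewrite no_edge_bb // mul0r.
(* For [h] in [G], the vertex [(g * h^-1) a] is adjacent to [g b] exactly when [h] lies in [D];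
   hence this substitution. *)
rewrite addr0 (reindex_inj (mulgI g)) (reindex_inj invg_inj).
rewrite [RHS]big_mkcond [LHS]big_mkcond /=.
apply: eq_bigr => h _; rewrite groupMl // groupV; case: ifPn => [Gh|NGh].
  rewrite sym_e edge_ab ?groupM ?groupV // invMg invgK mulgKV.
  by case: ifP; rewrite ?mul1r ?mul0r.
by case: ifP => // /connection_setG; rewrite (negPf NGh).
Qed.

Definition connection_sum (C : numClosedFieldType) (chi : {perm T} -> C) : C :=
  \sum_(h in D) chi h.

(** The eigenfunction is [chi] on the orbit of [a] and a unimodular multiple of [chi] on the orbit
    of [b], chosen so that both off-diagonal entries of the block become the modulus. *)
Lemma norm_connection_sum_eigenvalue (C : numClosedFieldType) (chi : {perm T} -> C) :
  linear_character G chi ->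
  eigenvalue (adjacency_matrix e C) `|connection_sum chi|.
Proof.
move=> chiL; set l := connection_sum chi.
(* [c] is the phase by which the eigenfunction on the orbit of [b] is rotated. *)
have [c [cl lc]] : exists c, c * l = `|l| /\ l^* = `|l| * c.
  have [l0|l_neq0] := eqVneq l 0.
    by exists 1; rewrite l0 normr0 mulr0 mul0r rmorph0.
  have nl_neq0 : `|l| != 0 by rewrite normr_eq0.
  exists (l^* / `|l|); split; last by rewrite mulrC divfK.
  by rewrite mulrAC (mulrC _ l) -normCK expr2 mulfK.
have [f fE] := orbit_function chi (fun g => c * chi g).
apply/(eigenvalue_adjacencyP sym_e); exists f.
  exists ((1%g : {perm T}) a); have [-> _] := fE 1%g (group1 G).
  by rewrite chiL.1 oner_eq0.
move=> x; have [g Gg [->|->]] := orbits_cover x.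
  rewrite neighbour_sum_a // (fE _ Gg).1 -cl mulrAC mulr_sumr.
  apply: eq_bigr => h /connection_setG Gh.
  by rewrite (fE _ (groupM Gg Gh)).2 chiL.2 // mulrA.
rewrite neighbour_sum_b // (fE _ Gg).2 mulrA -lc rmorph_sum /= mulr_suml.
apply: eq_bigr => h /connection_setG Gh.
rewrite (fE _ (groupM Gg (groupVr Gh))).1 chiL.2 ?groupV //.
by rewrite (linear_characterV chiL) // mulrC.
Qed.

(** Equality in the triangle inequality makes [chi] a constant [t] on [D]. The function with value
    [chi g] at [g a] and [chi g / t] at [g b] is then constant along edges, hence everywhere by
    connectedness; comparing [g a] with [a] gives the claim. *)
Lemma connection_sum_full (C : numClosedFieldType) (chi : {perm T} -> C) :
  (forall x y, connect e x y) -> linear_character G chi ->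
  `|connection_sum chi| = #|D|%:R -> {in G, forall g, chi g = 1}.
Proof.
move=> conn chiL full; have chi1 := norm_linear_character chiL.
have [t /eqP t1 chiD] : {t : C | `|t| == 1 & forall h, h \in D -> chi h = t}.
  apply: normC_sum_eq1 => [|h /connection_setG]; last exact: chi1.
  rewrite -/(connection_sum chi) full -sumr_const; apply: eq_bigr => h.
  by move=> /connection_setG /chi1.
have t_neq0 : t != 0 by rewrite -normr_eq0 t1 oner_eq0.
have [f fE] := orbit_function chi (fun g => chi g / t).
have f_ab g h : g \in G -> h \in G -> e (g a) (h b) -> f (g a) = f (h b).
  move=> Gg Gh; rewrite edge_ab // (fE _ Gg).1 (fE _ Gh).2 => /chiD.
  rewrite chiL.2 ?groupV // => <-.
  have chig : chi g^-1%g * chi g = 1 by rewrite -chiL.2 ?groupV // mulVg chiL.1.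
  have chih_neq0 : chi h != 0 by rewrite -normr_eq0 chi1 ?oner_eq0.
  have chigV_neq0 : chi g^-1%g != 0 by rewrite -normr_eq0 chi1 ?groupV ?oner_eq0.
  by apply: (mulfI chigV_neq0); rewrite chig invfM mulrCA mulVKf ?divff.
have f_const : closed e [pred x | f x == f a].
  suff f_edge x y : e x y -> f x = f y by move=> x y /f_edge; rewrite !inE => ->.
  have [g Gg [->|->]] := orbits_cover x; have [h Gh [->|->]] := orbits_cover y.
  - by rewrite no_edge_aa.
  - exact: f_ab.
  - by rewrite sym_e => /f_ab->.
  - by rewrite no_edge_bb.
move=> g Gg; have := closed_connect f_const (conn a (g a)).
rewrite !inE eqxx => /esym/eqP; rewrite (fE _ Gg).1 => ->.
by have [] := fE 1%g (group1 G); rewrite perm1 chiL.1.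
Qed.

(* The Fourier coefficients of an eigenfunction on the two orbits are exchanged,
   up to [connection_sum] and its conjugate, by the adjacency operator. *)
Lemma eigenvalue_connection_sum (C : numClosedFieldType) (I : finType)
    (chi : I -> {perm T} -> C) (l : C) :
  (forall i, linear_character G (chi i)) ->
  {in G, forall x, \sum_i chi i x = #|G|%:R * (x == 1%g)%:R} ->
  eigenvalue (adjacency_matrix e C) l ->
  exists i, l ^+ 2 = `|connection_sum (chi i)| ^+ 2.
Proof.
move=> chiL chi_sum /(eigenvalue_adjacencyP sym_e)[f [x fx_neq0] fE].
pose Fa i := \sum_(g in G) chi i g * f (g a).
pose Fb i := \sum_(g in G) chi i g * f (g b).
have lFa i : l * Fa i = (connection_sum (chi i))^* * Fb i.
  transitivity (\sum_(g in G) chi i g * \sum_(h in D) f ((g * h)%g b)).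
    rewrite mulr_sumr; apply: eq_bigr => g Gg.
    by rewrite mulrCA -fE neighbour_sum_a.
  have := linear_character_translate_sum
    (fun g : {perm T} => f (g b)) (chiL i) connection_setG.
  move=> ->; congr (_ * _); rewrite rmorph_sum; apply: eq_bigr => h.
  by move=> /connection_setG Gh; rewrite (linear_characterV (chiL i)).
have lFb i : l * Fb i = connection_sum (chi i) * Fa i.
  transitivity (\sum_(g in G) chi i g * \sum_(h in D) f ((g * h^-1)%g a)).
    rewrite mulr_sumr; apply: eq_bigr => g Gg.
    by rewrite mulrCA -fE neighbour_sum_b.
  have DVG : {in D, forall h, (h^-1)%g \in G}.
    by move=> h /connection_setG; rewrite groupV.
  have := linear_character_translate_sum
    (fun g : {perm T} => f (g a)) (chiL i) DVG.
  by move=> ->; congr (_ * _); apply: eq_bigr => h _; rewrite invgK.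
have [g Gg xE] := orbits_cover x.
(* Since [f x] is nonzero, some Fourier coefficient on the orbit containing [x] is nonzero. *)
have [i Fi] : exists i, (Fa i != 0) || (Fb i != 0).
  case: xE fx_neq0 => ->.
    move/(dual_detects (f := fun h : {perm T} => f (h a)) chiL chi_sum Gg).
    by case=> i Fi; exists i; rewrite Fi.
  move/(dual_detects (f := fun h : {perm T} => f (h b)) chiL chi_sum Gg).
  by case=> i Fi; exists i; rewrite Fi orbT.
(* Composing the two exchange relations shows that [l ^+ 2] and the squared modulus act equally on
   either coefficient; the nonzero one is cancelled. *)
exists i; rewrite normCK; case/orP: Fi => Fi_neq0; apply: (mulIf Fi_neq0).
  by rewrite expr2 -mulrA lFa mulrCA lFb mulrCA mulrA.
by rewrite expr2 -mulrA lFb mulrCA lFa mulrA.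
Qed.

End TwoRegularOrbits.

(** If [g a = h a], then [g * h^-1] fixes [a], so trivial stabilisers make the orbit map
    injective. *)
Lemma regular_orbit (T : finType) (G : {group {perm T}}) (S : {set T}) :
  acts_regularly G S ->
  exists2 a, a \in S &
    [/\ {in G &, injective (fun g : {perm T} => g a)},
        {in G, forall g : {perm T}, g a \in S} &
        forall x, x \in S -> exists2 g : {perm T}, g \in G & x = g a].
Proof.
move=> [trG stabG]; have /imsetP[a Sa SE] := trG; exists a => //; split.
- move=> g h Gg Gh gh_a; apply/eqP; rewrite eq_mulgV1.
  have : (g * h^-1)%g \in 'C_G[a | 'P]%g.
    rewrite inE groupM ?groupV //=; apply/astab1P.
    by rewrite /= /aperm permM gh_a permK.
  by rewrite stabG // => /set1gP/eqP.
- by move=> g Gg; rewrite SE; apply/imsetP; exists g.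
- by move=> x; rewrite SE => /imsetP[g Gg ->]; exists g.
Qed.

(** * Unit vectors built from characters *)

Section CharacterVectors.
Variables (R : realType) (gT : finGroupType) (d : nat) (D : {set gT}).
Hypotheses (d_gt0 : (0 < d)%N) (cardD : #|D| = d).

(** When [#|D| = d], the coordinates run through [D], each element exactly once. *)
Definition character_vector (chi : gT -> R[i]) : 'cV[R[i]]_d :=
  \col_(k < d) ((sqrtC d%:R)^-1 * chi (nth 1%g (enum D) k)).

Lemma hdot_character_vector (chi psi : gT -> R[i]) :
  hdot (character_vector chi) (character_vector psi) =
  d%:R^-1 * \sum_(h in D) (chi h)^* * psi h.
Proof.
rewrite /hdot mxE mulr_sumr -[RHS]big_enum /= (big_nth 1%g) -cardE cardD big_mkord.
apply: eq_bigr => k _; rewrite !mxE rmorphM /= fmorphV /=.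
rewrite (conj_Creal (ger0_real _)) ?sqrtC_ge0 ?ler0n // mulrACA.
by rewrite -invfM -expr2 sqrtCK.
Qed.

Lemma hdot_character_vector_self (G : {group gT}) (chi : gT -> R[i]) :
  {in D, forall h, h \in G} -> linear_character G chi ->
  hdot (character_vector chi) (character_vector chi) = 1.
Proof.
move=> DG chiL; rewrite hdot_character_vector (eq_bigr (fun _ => 1)) => [|h /DG Gh].
  by rewrite sumr_const cardD mulVf // pnatr_eq0 -lt0n.
by rewrite mulrC -normCK (norm_linear_character chiL) // expr1n.
Qed.

End CharacterVectors.

(** If [y] is [k] times [x], then [k] is the inner product, and the unit length of [y] gives [k]
    modulus 1. *)
Lemma norm_hdot_vline (R : realType) (d : nat) (x y : 'cV[R[i]]_d) :
  hdot x x = 1 -> hdot y y = 1 -> <[x]>%VS = <[y]>%VS -> `|hdot x y| = 1.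
Proof.
move=> xx yy xy; have /vlineP[k yE] : y \in <[x]>%VS by rewrite xy memv_line.
have hdotZ (u v : 'cV[R[i]]_d) c : hdot u (c *: v) = c * hdot u v.
  by rewrite /hdot -scalemxAr mxE.
have xy_k : hdot x y = k by rewrite yE hdotZ xx mulr1.
have hdotZl (u v : 'cV[R[i]]_d) c : hdot (c *: u) v = c^* * hdot u v.
  by rewrite /hdot !mxE mulr_sumr; apply: eq_bigr => i _; rewrite !mxE rmorphM mulrA.
have : `|k| ^+ 2 = 1 by rewrite -yy yE hdotZ hdotZl xx mulr1 -normCK.
by move/eqP; rewrite -xy_k sqrp_eq1 // => /eqP.
Qed.

(** * The distance set formed by all character vectors *)

Unset Implicit Arguments.

Theorem theorem4p2p5 (R : realType) (T : finType) (e : rel T) (d s : nat)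
    (A B : {set T}) (G : {group {perm T}}) :
  simple_graph e ->
  connected_graph e ->
  bipartition e A B ->
  (1 <= d)%N ->
  regular_graph e d ->
  (forall g : {perm T}, g \in G -> graph_automorphism e g) ->
  abelian G ->
  acts_regularly G A ->
  acts_regularly G B ->
  ([set `|a| | a in [set a : R[i] | nontrivial_eigenvalue e d a]]%classic
     #= `I_s)%card ->
  exists X : set 'cV[R[i]]_d,
    distance_set s X /\ (X #= `I_#|G|)%card.
Proof.
move=> [sym_e irr_e] [_ conn] [AB disjAB bip] d_gt0 reg autG abG regA regB card_s.
have [a Aa [a_inj Ga aG]] := regular_orbit regA.
have [b Bb [b_inj Gb bG]] := regular_orbit regB.
have B_notA x : x \in B -> x \notin A.
  by move=> Bx; apply/negP => Ax; have := disjointFr disjAB Ax; rewrite Bx.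
have a_neq_b : {in G &, forall g h : {perm T}, g a <> h b}.
  by move=> g h /Ga Ag /Gb /B_notA /negP Bh gh; apply: Bh; rewrite -gh.
have cover x : exists2 g : {perm T}, g \in G & x = g a \/ x = g b.
  have : x \in A :|: B by rewrite AB inE.
  by case/setUP => [/aG|/bG] [g Gg ->]; exists g; auto.
have a_indep : {in G, forall g : {perm T}, ~~ e a (g a)}.
  by move=> g /Ga Ag; apply/negP => /bip; rewrite Aa Ag.
have b_indep : {in G, forall g : {perm T}, ~~ e b (g b)}.
  move=> g /Gb /B_notA/negPf Bg; apply/negP => /bip.
  by rewrite Bg (negPf (B_notA _ Bb)).
pose D := connection_set e G a b.
have DG : {in D, forall h, h \in G} by exact: connection_setG.
have cardD : #|D| = d by apply: card_connection_set.
have [I [chi [cardI chiL chi_inj chi_sum]]] := abelian_dual R[i] abG.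
pose S := @connection_sum T e G a b R[i].
have S_full := connection_sum_full sym_e abG autG a_inj b_inj a_neq_b cover
  a_indep b_indep (C := R[i]).
(* The value [d] would force [psi] to be trivial, and [- d] is excluded by sign because [d] is
   positive. *)
have S_nontrivial psi : linear_character G psi ->
    ~ {in G, forall g, psi g = 1} -> nontrivial_eigenvalue e d `|S psi|.
  move=> psiL psi_neq1; split.
  - exact: norm_connection_sum_eigenvalue.
  - by move=> S_d; apply: psi_neq1; apply: S_full; rewrite // S_d -cardD.
  - move=> S_d; have := normr_ge0 (S psi).
    by rewrite S_d oppr_ge0 lern0 eqn0Ngt d_gt0.
have chi_quot i j : linear_character G (fun g => (chi i g)^* * chi j g).
  exact: linear_character_conjM.
have chi_quot_neq1 i j : i <> j ->
    ~ {in G, forall g, (chi i g)^* * chi j g = 1}.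
  move=> neq_ij ij1; apply: neq_ij; apply: chi_inj => g Gg.
  have /(congr1 ( *%R (chi i g))) := ij1 g Gg.
  by rewrite mulrA -normCK (norm_linear_character (chiL i)) // expr1n mul1r mulr1.
pose v i := character_vector d D (chi i).
have vv i : hdot (v i) (v i) = 1.
  exact: (hdot_character_vector_self d_gt0 cardD (G := G)).
have vE i j : hdot (v i) (v j) = d%:R^-1 * S (fun g => (chi i g)^* * chi j g).
  exact: hdot_character_vector.
have v_lines i j : i <> j -> <[v i]>%VS <> <[v j]>%VS.
  move=> neq_ij /(norm_hdot_vline (vv i) (vv j)).
  rewrite vE normrM normfV normr_nat => S_d.
  (* A common line would give the connection sum of the quotient character modulus [d], which is not
     a nontrivial eigenvalue. *)
  have [_ + _] := S_nontrivial _ (chi_quot i j) (chi_quot_neq1 _ _ neq_ij); apply.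
  by rewrite -[LHS](mulVKf (_ : d%:R != 0)) ?S_d ?mulr1 // pnatr_eq0 -lt0n.
have v_inj : injective v.
  move=> i j vij; have [//|/eqP/v_lines[]] := eqVneq i j.
  by rewrite vij.
exists (range v); split; last first.
  have v'_inj : injective (v \o (enum_val : 'I_#|I| -> I)).
    exact: inj_comp v_inj enum_val_inj.
  have -> : range v = range (v \o (enum_val : 'I_#|I| -> I)).
    apply/seteqP; split=> _ [i _ <-]; last by exists (enum_val i).
    by exists (enum_rank i) => //=; rewrite enum_rankK.
  rewrite -cardI; apply: card_eq_trans (inj_card_eq _) _ => [i j _ _|].
    exact: v'_inj.
  by rewrite card_eq_sym card_II.
split.
- by move=> _ [i _ <-].
- by move=> _ _ [i _ <-] [j _ <-] neq; apply: v_lines => ij; apply: neq; rewrite ij.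
pose E : set R[i] :=
  [set `|a| | a in [set a : R[i] | nontrivial_eigenvalue e d a]]%classic.
rewrite -/E in card_s.
(* The squared inner products are the image of [E] under division by [d] followed by squaring. *)
have -> : [set r : R[i] | exists x y, [/\ range v x, range v y, x <> y
    & r = `|hdot x y| ^+ 2]]%classic = [set (d%:R^-1 * r) ^+ 2 | r in E]%classic.
  apply/seteqP; split=> [_ [_ [_ [[i _ <-] [j _ <-] neq ->]]]|].
    have neq_ij : i <> j by move=> ij; apply: neq; rewrite ij.
    exists `|S (fun g => (chi i g)^* * chi j g)|.
      exists `|S (fun g => (chi i g)^* * chi j g)|; last by rewrite normr_id.
      exact: S_nontrivial _ (chi_quot i j) (chi_quot_neq1 _ _ neq_ij).
    by rewrite vE normrM normfV normr_nat.
  move=> _ [_ [l [l_eig l_neq l_neqN] <-] <-].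
  (* The trivial character is in the family: the constant function 1 has a nonzero coefficient, and
     a character with nonzero sum is trivial. Pairing it with [chi j] realises the sum over [D] of
     [chi j] itself. *)
  have [i1 chi_i1] : exists i1, {in G, forall g, chi i1 g = 1}.
    have [i1 i1P] := dual_detects (f := fun=> 1) chiL chi_sum (group1 G) (oner_neq0 _).
    exists i1; apply: sum_linear_character_neq0 => //.
    by under eq_bigr do rewrite -[chi _ _]mulr1.
  have [j lj] : exists j, l ^+ 2 = `|S (chi j)| ^+ 2.
    exact: (eigenvalue_connection_sum (a := a) (b := b)).
  (* If [j] were the trivial index, then [l ^+ 2] would be the square of [d], making [l] a trivial
     eigenvalue. *)
  have neq_j : i1 <> j.
    move=> ij; move/eqP: lj; rewrite -ij.
    have -> : S (chi i1) = d%:R.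
      transitivity (\sum_(h in D) (1 : R[i])); last by rewrite sumr_const cardD.
      by apply: eq_bigr => h /DG /chi_i1.
    by rewrite normr_nat eqf_sqr => /orP[] /eqP.
  exists (v i1), (v j); split=> //; first by move/v_inj.
  rewrite vE normrM normfV normr_nat !exprMn -normrX lj normrX normr_id.
  congr (_ * `|_| ^+ 2); apply: eq_bigr => h /DG Gh.
  by rewrite chi_i1 // rmorph1 mul1r.
(* On nonnegative numbers, scaling by the inverse of [d] and squaring is injective, so the image of
   [E] still has [s] elements. *)
apply: card_eq_trans card_s; apply: inj_card_eq => r t.
rewrite !inE => -[x _ <-] [y _ <-] /eqP.
have dV_ge0 : 0 <= (d%:R : R[i])^-1 by rewrite invr_ge0 ler0n.
rewrite eqrXn2 ?mulr_ge0 // => /eqP/mulfI; apply.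
by rewrite invr_eq0 pnatr_eq0 -lt0n.
Qed.
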